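(* Let $X$ be a graph with adjacency matrix $A=A(X)$ in the Bose-Mesner algebra of an association scheme $\{A_0,A_1,\ldots,A_d\}$ with minimal idempotents $\{E_0,E_1,\ldots,E_d\}$. Suppose the eigenvalues of $A$ are given by $\theta_0\ge\theta_1\ge\cdots\ge\theta_d$, where $A=\sum_{r=0}^d\theta_rE_r$. Let $U(t)=e^{-\mathrm{i}tA}$. There are real scalars $\alpha,\zeta$ and a complex scalar $\beta$ so that the graph $X$ has $e^{\mathrm{i}\zeta}(\alpha,\beta)$ fractional revival from $a$ to $b$ at time $\tau$ if and only if both the following conditions hold: (a) the unique class $A_q$ of the scheme which is non-zero in the $(a,b)$ entry is a permutation matrix of order $2$ (and so its eigenvalues are $\pm1$); and (b) for all $r\in\{1,\ldots,d\}$, if $A_qE_r=E_r$, then $(\theta_r-\theta_0)\tau\equiv0\pmod{2\pi}$, and if $A_qE_r=-E_r$, then $(\theta_r-\theta_0)\tau\equiv2\cos^{-1}(\alpha)\pmod{2\pi}$. Here the $\alpha$ in (b) is the same $\alpha$ as in the revival. If the conditions hold, then fractional revival occurs between all pairs of vertices determined by $A_q$, as in fact $U(\tau)=e^{\mathrm{i}\zeta}(\alpha I+\beta A_q)$.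
   Context: A (symmetric) association scheme is a set of $n\times n$ symmetric $01$-matrices $\{A_0,\ldots,A_d\}$ (its classes) with $A_0=I$, $\sum_iA_i=J$ (the all-ones matrix), and every product $A_iA_j$ a linear combination of $A_0,\ldots,A_d$. The $A_i$ span a commutative algebra (the Bose-Mesner algebra), which also has a basis $E_0,\ldots,E_d$ of minimal idempotents, the orthogonal projections onto the common eigenspaces; $E_0=\frac1nJ$. For distinct vertices $a,b$ and $\tau>0$, $X$ has $e^{\mathrm{i}\zeta}(\alpha,\beta)$ fractional revival from $a$ to $b$ at time $\tau$ if $U(\tau)\mathbf{e}_a=e^{\mathrm{i}\zeta}(\alpha\mathbf{e}_a+\beta\mathbf{e}_b)$, with $\beta\ne0$ and $|\alpha|^2+|\beta|^2=1$, where $\mathbf{e}_a$ is the standard basis vector indexed by $a$. The pairs of vertices determined by $A_q$ are the pairs $u,v$ with $(A_q)_{u,v}=1$. Congruence modulo $2\pi$ means that the difference is an integer multiple of $2\pi$. *)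

(* Defs.v *)
From HB Require Import structures.
From mathcomp Require Import all_boot all_order all_algebra all_fingroup.
From mathcomp Require Import complex.
From mathcomp Require Import boolp classical_sets reals topology normedtype.
From mathcomp Require Import sequences trigo.

Set Implicit Arguments.
Unset Strict Implicit.
Unset Printing Implicit Defensive.

Import Order.TTheory GRing.Theory Num.Theory.
Import numFieldNormedType.Exports.

Local Open Scope classical_set_scope.
Local Open Scope ring_scope.
Local Open Scope complex_scope.

Section Schemes.
Variables (R : realType) (n d : nat).
Implicit Types (S E : 'I_d.+1 -> 'M[R]_n) (B : {vspace 'M[R]_n}).

Definition bose_mesner S : {vspace 'M[R]_n} := <<codom S>>%VS.

(* The classes are required to be nonzero; as they sum to J, they then have
   disjoint nonempty supports and are in particular distinct. *)
Definition association_scheme S : Prop :=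
  [/\ forall i, (S i)^T = S i /\ S i != 0,
      forall i x y, S i x y = 0 \/ S i x y = 1,
      S ord0 = 1%:M,
      \sum_i S i = const_mx 1
    & forall i j, S i *m S j \in bose_mesner S].

(* For F in a commutative algebra containing the idempotent E, F *m E = F says
   that F lies below E. *)
Definition minimal_idempotent B (E : 'M[R]_n) : Prop :=
  [/\ E \in B, E != 0, E *m E = E
    & forall F, F \in B -> F *m F = F -> F *m E = F -> F = 0 \/ F = E].

(* E_0, ..., E_d lists without repetition all the minimal idempotents of the
   Bose-Mesner algebra, starting with J / n. *)
Definition scheme_idempotents S E : Prop :=
  [/\ injective E,
      forall M, minimal_idempotent (bose_mesner S) M <-> exists r, M = E r
    & E ord0 = const_mx n%:R^-1].

Definition adjacency_mx (e : rel 'I_n) : 'M[R]_n :=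
  \matrix_(i, j) (e i j)%:R.

Definition order2_perm_mx (P : 'M[R]_n) : Prop :=
  exists s : {perm 'I_n}, P = perm_mx s /\ #[s]%g = 2%N.

Definition eqmod2pi (x y : R) : Prop :=
  exists k : int, x - y = k%:~R * (2 * pi).

Definition phase_condition E (theta : 'I_d.+1 -> R) (P : 'M[R]_n)
    (tau alpha : R) : Prop :=
  forall r : 'I_d.+1, r != ord0 ->
    (P *m E r = E r -> eqmod2pi ((theta r - theta ord0) * tau) 0) /\
    (P *m E r = - E r ->
       eqmod2pi ((theta r - theta ord0) * tau) (2 * acos alpha)).

End Schemes.

(* The exponential series, summed entrywise. *)
Definition expmx (C : numFieldType) (n : nat) (M : 'M[C]_n) : 'M[C]_n :=
  \matrix_(i, j)
    limn (series (fun k : nat => ((k`!%:R)^-1 *: M ^+ k) i j)).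

Section Walks.
Variables (R : realType) (n : nat).
Implicit Types (A : 'M[R]_n).

Definition cplx_mx A : 'M[R[i]]_n := map_mx (real_complex R) A.

Definition cis (x : R) : R[i] := cos x +i* sin x.

Definition transition_mx A (t : R) : 'M[R[i]]_n :=
  expmx ((0 -i* t) *: cplx_mx A).

Definition basis_vec (a : 'I_n) : 'cV[R[i]]_n := delta_mx a ord0.

Definition fractional_revival A (a b : 'I_n) (tau zeta alpha : R)
    (beta : R[i]) : Prop :=
  [/\ a != b, 0 < tau, beta != 0, `|alpha%:C| ^+ 2 + `|beta| ^+ 2 = 1
    & transition_mx A tau *m basis_vec a =
        cis zeta *: (alpha%:C *: basis_vec a + beta *: basis_vec b)].

End Walks.

(* Main.v *)
(* Every matrix of the Bose-Mesner algebra, hence also U(tau), is constant on the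
   pairs of vertices lying in a common class, and every class has a nonzero entry
   in every column. Column a of U(tau) therefore determines U(tau): revival from a
   to b forces U(tau) = e^(i zeta) (alpha I + beta A_q) and puts a single 1 in
   column a of A_q, and since the row sums of A_q agree, A_q is a permutation
   matrix. Comparing both sides on each E_r, where A_q acts as 1 or -1, yields
   the phase conditions; conversely, these determine U(tau) = sum_r
   e^(-i tau theta_r) E_r, with alpha = cos phi and beta = i sin phi. *)
Require Import Defs.
From HB Require Import structures.
From mathcomp Require Import all_boot all_order all_algebra all_fingroup.
From mathcomp Require Import complex.
From mathcomp Require Import boolp classical_sets reals topology normedtype.
From mathcomp Require Import sequences trigo.
From mathcomp Require Import ring lra.

Set Implicit Arguments.
Unset Strict Implicit.
Unset Printing Implicit Defensive.

Import Order.TTheory GRing.Theory Num.Theory.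
Import numFieldNormedType.Exports.

Local Open Scope ring_scope.
Local Open Scope complex_scope.

(** * Unit complex numbers and congruence modulo 2 pi *)

Lemma cisD (R : realType) (x y : R) : cis (x + y) = cis x * cis y.
Proof.
by rewrite /cis cosD sinD; simpc; congr (_ +i* _); rewrite addrC.
Qed.

Lemma cis0 (R : realType) : cis (0 : R) = 1.
Proof. by rewrite /cis cos0 sin0. Qed.

Lemma cisN (R : realType) (x : R) : cis x * cis (- x) = 1.
Proof. by rewrite -cisD subrr cis0. Qed.

Lemma cis_neq0 (R : realType) (x : R) : cis x != 0.
Proof.
by apply/eqP => h; move: (cisN x); rewrite h mul0r => /eqP; rewrite eq_sym oner_eq0.
Qed.

Lemma normr_cis (R : realType) (x : R) : `|cis x| = 1.
Proof. by rewrite normc_def /= cos2Dsin2 sqrtr1. Qed.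

Lemma cis_period (R : realType) (k : int) : cis (k%:~R * (2 * pi) : R) = 1.
Proof.
have cis2pi : cis (2 * pi : R) = 1.
  rewrite mulr_natl /cis -[pi *+ 2]add0r.
  by rewrite cosD2pi sinD2pi cos0 sin0.
have cisn (m : nat) : cis (m%:R * (2 * pi) : R) = 1.
  elim: m => [|m IH]; first by rewrite mul0r cis0.
  by rewrite -natr1 mulrDl mul1r cisD IH cis2pi mulr1.
case: k => m; first exact: cisn.
by rewrite NegzE mulrNz mulNr -[LHS]mul1r -[X in X * _](cisn m.+1) cisN.
Qed.

(** After reduction modulo 2 pi to [y] in [0, 2 pi[, cos y = 1 forces sin (y / 2) = 0, and sine has
    no zero in ]0, pi[. *)
Lemma cis_eq1 (R : realType) (x : R) :
  cis x = 1 -> exists k : int, x = k%:~R * (2 * pi).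
Proof.
move=> cisx; have pi0 : 0 < 2 * pi :> R by rewrite mulr_gt0 ?pi_gt0.
pose k := Num.floor (x / (2 * pi)); exists k.
pose y := x - k%:~R * (2 * pi).
have cisy : cis y = 1.
  by rewrite -[LHS]mulr1 -[X in _ * X](cis_period R k) -cisD subrK.
have /andP[] := floor_itv (x / (2 * pi)); rewrite -/k.
rewrite ler_pdivlMr // ltr_pdivrMr // intrD (mulrDl k%:~R) mul1r => k1 k2.
have y0 : 0 <= y by rewrite subr_ge0.
have y2 : y < 2 * pi by rewrite /y ltrBlDl.
have : cos y = 1 by case: cisy.
have -> : y = (y / 2) *+ 2 by rewrite -mulr_natr divfK // pnatr_eq0.
rewrite cos_mulr2n cos2sin2 => h.
have : sin (y / 2) ^+ 2 = 0 by lra.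
move=> /eqP; rewrite sqrf_eq0 => /eqP sy.
apply/eqP; rewrite -subr_eq0 -/y eq_le y0 andbT leNgt; apply/negP => y_gt0.
have := @sin_gt0_pi R (y / 2); rewrite sy ltxx.
by move=> /(_ _)/notF; apply; apply/andP; split; lra.
Qed.

Lemma eqmod2piP (R : realType) (x y : R) : eqmod2pi x y <-> cis x = cis y.
Proof.
split=> [[k xy]|xy].
  by rewrite -[x](subrK y) xy cisD cis_period mul1r.
by apply: cis_eq1; rewrite cisD xy cisN.
Qed.

(** * The exponential series at imaginary arguments *)

Lemma cvg_complex (R : realType) (u v : nat -> R) (a b : R) :
  (u @ \oo --> a)%classic -> (v @ \oo --> b)%classic ->
  ((fun k => (u k +i* v k : (R[i] : numFieldType))) @ \oo
     --> (a +i* b : (R[i] : numFieldType)))%classic.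
Proof.
move=> /cvgrPdist_lt ua /cvgrPdist_lt vb; apply/cvgrPdist_lt => eps eps0.
(* A positive element of [R[i]] has zero imaginary part, so the tolerance is real. *)
have [e e0 ->] : exists2 e : R, 0 < e & eps = e%:C.
  case: eps eps0 => x y; rewrite ltcE /= => /andP[/eqP -> x0].
  by exists x.
have e20 : 0 < e / 2 by rewrite divr_gt0.
near=> k.
have -> : (a +i* b) - (u k +i* v k) = (a - u k)%:C + 'i * (b - v k)%:C.
  by simpc.
apply: le_lt_trans (ler_normD _ _) _; rewrite normrM.
have -> : `|'i : R[i]| = 1 by rewrite normc_def /= expr0n expr1n add0r sqrtr1.
have nr (z : R) : `|z%:C| = `|z|%:C.
  by rewrite normc_def /= expr0n addr0 sqrtr_sqr.
rewrite mul1r !nr -rmorphD ltcR (splitr e) ltrD //.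
  by near: k; exact: ua.
by near: k; exact: vb.
Unshelve. all: by end_near. Qed.

(** Matches the exponential series at - i x term by term with the cosine and sine series; the parity
    of [k] selects the real or the imaginary part. *)
Lemma imaginary_coeff (R : realType) (x : R) (k : nat) :
  (k`!%:R)^-1 * (0 -i* x) ^+ k = cos_coeff x k -i* sin_coeff x k.
Proof.
have -> : (0 -i* x) ^+ k =
    (x ^+ k * ((~~ odd k)%:R * (-1) ^+ k./2))
      -i* (x ^+ k * ((odd k)%:R * (-1) ^+ k.-1./2)).
  elim: k => [|k IH]; first by rewrite !expr0 !mul1r mul0r oppr0.
  have h : odd k -> (k./2 = k.-1./2)%N.
    by case: k {IH} => //= k /negPf; rewrite uphalf_half => ->.
  rewrite exprSr IH; apply/eqP; rewrite eq_complex /= negbK uphalf_half.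
  case: (boolP (odd k)) h => [_ -> //|_ _] /=; rewrite ?add1n ?add0n ?exprS;
    by apply/andP; split; apply/eqP; ring.
have -> : (k`!%:R : R[i])^-1 = (k`!%:R^-1)%:C by rewrite fmorphV rmorph_nat.
rewrite /cos_coeff /sin_coeff; apply/eqP.
rewrite eq_complex /= -?exprnP.
by apply/andP; split; apply/eqP; ring.
Qed.

Lemma cvg_exp_imaginary (R : realType) (x : R) :
  (series (fun k : nat => (k`!%:R)^-1 * (0 -i* x) ^+ k : (R[i] : numFieldType))
     @ \oo --> (cis (- x) : (R[i] : numFieldType)))%classic.
Proof.
rewrite /cis cosN sinN.
have cc : (series (cos_coeff x) @ \oo --> cos x)%classic.
  by rewrite cos.unlock; exact: is_cvg_series_cos_coeff.
have cs : (series (sin_coeff x) @ \oo --> sin x)%classic.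
  by rewrite sin.unlock; exact: is_cvg_series_sin_coeff.
have -> : series (fun k => (k`!%:R)^-1 * (0 -i* x) ^+ k) =
    fun N => series (cos_coeff x) N -i* series (sin_coeff x) N.
  apply/funext; elim=> [|N IH]; rewrite /series /=.
    by rewrite !big_nil oppr0.
  by rewrite !big_nat_recr //= [X in X + _]IH imaginary_coeff opprD; simpc.
exact: cvg_complex cc (cvgN cs).
Qed.

(** * Spectral form of the transition matrix *)

Lemma expr_sum_idempotents (F : comPzRingType) (n d : nat) (c : 'I_d -> F)
    (P : 'I_d -> 'M[F]_n) (k : nat) :
    \sum_r P r = 1%:M -> (forall r s, P r *m P s = if r == s then P r else 0) ->
  (\sum_r c r *: P r) ^+ k = \sum_r c r ^+ k *: P r.
Proof.
move=> P1 PP; elim: k => [|k IH].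
  by rewrite expr0 -[1]P1; apply: eq_bigr => r _; rewrite expr0 scale1r.
rewrite exprS IH -[_ * _]/(_ *m _) mulmx_suml; apply: eq_bigr => r _.
rewrite mulmx_sumr (bigD1 r) //= big1 ?addr0 => [|s sr].
  by rewrite -scalemxAl -scalemxAr PP eqxx scalerA exprS.
by rewrite -scalemxAl -scalemxAr PP eq_sym (negPf sr) !scaler0.
Qed.

(** Powers of the matrix act on each [E r] through powers of [theta r], so every entry of the series
    is a finite combination of scalar exponential series. *)
Lemma transition_mx_spectral (R : realType) (n d : nat) (E : 'I_d -> 'M[R]_n)
    (theta : 'I_d -> R) (t : R) :
    \sum_r E r = 1%:M -> (forall r s, E r *m E s = if r == s then E r else 0) ->
  transition_mx (\sum_r theta r *: E r) t =
    \sum_r cis (- (theta r * t)) *: cplx_mx (E r).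
Proof.
move=> E1 EE.
rewrite /transition_mx; have -> : (0 -i* t) *: cplx_mx (\sum_r theta r *: E r) =
    \sum_r (0 -i* (theta r * t)) *: cplx_mx (E r).
  rewrite /cplx_mx raddf_sum scaler_sumr; apply: eq_bigr => r _ /=.
  rewrite map_mxZ scalerA; congr (_ *: _); simpc.
  by rewrite mulrC.
apply/matrixP => i j; rewrite mxE summxE.
apply: (@cvg_lim (R[i] : numFieldType)); first exact: norm_hausdorff.
rewrite [X in fmap X _](_ : _ = fun N => \sum_r
    series (fun k => k`!%:R^-1 * (0 -i* (theta r * t)) ^+ k) N * cplx_mx (E r) i j);
  last first.
  apply/funext => N; rewrite /series /=.
  under [RHS]eq_bigr => r _ do rewrite mulr_suml.
  rewrite exchange_big /=; apply: eq_bigr => k _.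
  rewrite expr_sum_idempotents //.
  - rewrite mxE summxE mulr_sumr; by apply: eq_bigr => r _; rewrite mxE mulrA.
  - by rewrite -(map_mx1 (real_complex R)) -E1 [RHS]raddf_sum.
  - move=> r s; rewrite /cplx_mx -map_mxM EE; case: eqP => // _.
    by rewrite raddf0.
  apply: cvg_big => [|r _]; first exact: add_continuous.
  by rewrite !mxE; apply: cvgMr_tmp; exact: cvg_exp_imaginary.
Qed.

(** * Classes and idempotents of a scheme *)

Lemma sum_01_eq1 (F : numDomainType) (I : finType) (f : I -> F) :
    (forall i, f i = 0 \/ f i = 1) -> \sum_i f i = 1 ->
  exists j, forall i, f i = (i == j)%:R.
Proof.
move=> f01 f1.
have [j fj] : exists j, f j = 1.
  apply: contrapT => /forallNP nf; move/eqP: f1.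
  rewrite big1 ?(eq_sym 0) ?oner_eq0 // => i _.
  by case: (f01 i) => // /nf.
exists j => i; case: eqVneq => [->//|ij].
have s0 : \sum_(k | k != j) f k = 0.
  by move: f1; rewrite (bigD1 j) //= fj => /(canRL (addKr _)); rewrite addNr.
apply: (psumr_eq0P _ s0) ij => k _.
by case: (f01 k) => ->.
Qed.

Section Scheme.
Variables (R : realType) (n d : nat) (S E : 'I_d.+1 -> 'M[R]_n).
Hypothesis hS : association_scheme S.
Hypothesis hE : scheme_idempotents S E.
Local Notation BM := (bose_mesner S).

Lemma mem_scheme i : S i \in BM.
Proof. exact/memv_span/codom_f. Qed.

Lemma bose_mesnerP M : M \in BM -> exists c, M = \sum_i c i *: S i.
Proof.
rewrite /bose_mesner span_def big_image /= => /memv_sumP[v vE ->].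
have /choice[c cE] : forall i, exists c, v i = c *: S i.
  by move=> i; apply/vlineP/vE.
by exists c; apply: eq_bigr.
Qed.

Lemma mem1_bose_mesner : 1%:M \in BM.
Proof. by have [_ _ <- _ _] := hS; exact: mem_scheme. Qed.

Lemma bose_mesner_tr M : M \in BM -> M^T = M.
Proof.
have [Ssym _ _ _ _] := hS; move=> /bose_mesnerP[c ->].
by rewrite raddf_sum; apply: eq_bigr => i _ /=; rewrite linearZ /= (Ssym i).1.
Qed.

Lemma bose_mesner_mul M N : M \in BM -> N \in BM -> M *m N \in BM.
Proof.
have [_ _ _ _ SS] := hS; move=> /bose_mesnerP[c ->] /bose_mesnerP[c' ->].
rewrite mulmx_suml rpred_sum // => i _; rewrite mulmx_sumr rpred_sum // => j _.
by rewrite -scalemxAl -scalemxAr !rpredZ.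
Qed.

(** Products in the algebra are again symmetric, so M N = (M N)^T = N^T M^T = N M. *)
Lemma bose_mesner_comm M N : M \in BM -> N \in BM -> M *m N = N *m M.
Proof.
move=> MB NB; rewrite -[LHS](bose_mesner_tr (bose_mesner_mul MB NB)) trmx_mul.
by rewrite !bose_mesner_tr.
Qed.

Lemma scheme_class x y : exists q, forall i, S i x y = (i == q)%:R.
Proof.
have [_ S01 _ SJ _] := hS; apply: sum_01_eq1 => [i|]; first exact: S01.
by rewrite -summxE SJ mxE.
Qed.

(** At a position in class [i] no other class contributes: the entry is the coefficient of [S i]. *)
Lemma bose_mesner_const M i x y u v :
  M \in BM -> S i x y = 1 -> S i u v = 1 -> M x y = M u v.
Proof.
have class1 z w : S i z w = 1 -> forall j, S j z w = (j == i)%:R.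
  have [q qE] := scheme_class z w; rewrite qE => /eqP.
  by rewrite pnatr_eq1 eqb1 => /eqP ->.
move=> /bose_mesnerP[c ->] /class1 xy /class1 uv.
by rewrite !summxE; apply: eq_bigr => j _; rewrite !mxE xy uv.
Qed.

(* The diagonal of [S i *m S i], which holds the row sums of [S i], is constant. *)
Lemma scheme_row_norm i x y :
  \sum_z S i x z = \sum_z S i y z.
Proof.
have [Ssym S01 S1 _ SS] := hS.
have diagE z : (S i *m S i) z z = \sum_w S i z w.
  rewrite mxE; apply: eq_bigr => w _.
  rewrite -{2}(Ssym i).1 mxE; case: (S01 i z w) => ->; by rewrite ?mulr0 ?mulr1.
rewrite -!diagE; apply: (@bose_mesner_const _ ord0) => //; by rewrite S1 mxE eqxx.
Qed.

(** One zero row would make all row sums vanish, hence [S i] itself. This lets every class be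
    reached from a single column. *)
Lemma scheme_neighbor i x : exists y, S i x y = 1.
Proof.
have [Ssym S01 _ _ _] := hS; apply: contrapT => /forallNP nS.
have /eqP[] := (Ssym i).2; apply/matrixP => y z; rewrite mxE.
have : \sum_w S i y w = 0.
  rewrite (scheme_row_norm i y x) big1 // => w _.
  by case: (S01 i x w) => // /nS.
by move=> /psumr_eq0P; apply=> // w _; case: (S01 i y w) => ->.
Qed.

Lemma mem_scheme_idempotent r : E r \in BM.
Proof. by have [_ EP _] := hE; have [] := (EP (E r)).2 (ex_intro _ r erefl). Qed.

Lemma scheme_idempotent_neq0 r : E r != 0.
Proof. by have [_ EP _] := hE; have [] := (EP (E r)).2 (ex_intro _ r erefl). Qed.

(** The product is an idempotent below both factors. By minimality it is 0 or equals both, and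
    injectivity of [E] excludes the latter when [r != s]. *)
Lemma scheme_idempotent_mul r s : E r *m E s = if r == s then E r else 0.
Proof.
have [Einj EP _] := hE.
have [rB _ rr rmin] := (EP (E r)).2 (ex_intro _ r erefl).
have [sB _ ss smin] := (EP (E s)).2 (ex_intro _ s erefl).
case: eqVneq => [<- //|rs].
have rsB := bose_mesner_mul rB sB.
have rsr : E r *m E s *m E r = E r *m E s.
  by rewrite (bose_mesner_comm rB sB) -mulmxA rr.
have rss : E r *m E s *m E s = E r *m E s by rewrite -mulmxA ss.
have rsid : E r *m E s *m (E r *m E s) = E r *m E s by rewrite mulmxA rsr rss.
have [//|rE] := rmin _ rsB rsid rsr.
have [//|sE] := smin _ rsB rsid rss.
by case/eqP: rs; apply: Einj; rewrite -rE sE.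
Qed.

(* As many pairwise orthogonal nonzero matrices as classes: a basis. *)
Lemma bose_mesner_spectral M : M \in BM -> exists c, M = \sum_r c r *: E r.
Proof.
have En (i : 'I_d.+1) : [tuple E i | i < d.+1]`_i = E i by rewrite -tnth_nth tnth_mktuple.
have Efree : free [tuple E i | i < d.+1].
  apply/freeP => k; under eq_bigr => j _ do rewrite En.
  move=> k0 i; have /(congr1 (mulmxr (E i))) := k0.
  rewrite /= mul0mx mulmx_suml (bigD1 i) //= big1 ?addr0 => [|j ji];
    rewrite -scalemxAl scheme_idempotent_mul ?eqxx ?(negPf ji) ?scaler0 //.
  by move/eqP; rewrite scaler_eq0 (negPf (scheme_idempotent_neq0 i)) orbF => /eqP.
have /andP[/eqP <- _] : basis_of BM [tuple E i | i < d.+1].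
  rewrite basisEfree Efree /=; apply/andP; split.
    by apply/span_subvP => _ /mapP[i _ ->]; exact: mem_scheme_idempotent.
  by rewrite (leq_trans (dim_span _)) // size_tuple size_codom card_ord.
move=> /coord_span ->; exists (fun r => coord [tuple E i | i < d.+1] r M).
by apply: eq_bigr => i _; rewrite En.
Qed.

(** Multiplying the expansion of 1 by [E r] gives E_r = c_r E_r. *)
Lemma sum_scheme_idempotents : \sum_r E r = 1%:M.
Proof.
have [c c1] := bose_mesner_spectral mem1_bose_mesner.
rewrite c1; apply: eq_bigr => r _; rewrite -[LHS]mul1mx c1 mulmx_suml.
rewrite (bigD1 r) //= big1 ?addr0 => [|s sr];
  rewrite -scalemxAl scheme_idempotent_mul ?eqxx //.
by rewrite (negPf sr) scaler0.
Qed.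

(** [P] acts on [E r] as a scalar, whose square is 1. *)
Lemma involution_idempotent P r : P \in BM -> P *m P = 1%:M ->
  P *m E r = E r \/ P *m E r = - E r.
Proof.
move=> /bose_mesner_spectral[c cP] PP.
have PE : P *m E r = c r *: E r.
  rewrite cP mulmx_suml (bigD1 r) //= big1 ?addr0 => [|s sr];
    rewrite -scalemxAl scheme_idempotent_mul ?eqxx //.
  by rewrite (negPf sr) scaler0.
have /eqP : (c r ^+ 2 - 1) *: E r = 0.
  by rewrite scalerBl scale1r expr2 -scalerA -PE scalemxAr -PE mulmxA PP mul1mx subrr.
rewrite scaler_eq0 (negPf (scheme_idempotent_neq0 r)) orbF subr_eq0 sqrf_eq1 PE.
by case/orP => /eqP ->; [left|right]; rewrite ?scale1r ?scaleN1r.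
Qed.

End Scheme.

(** * Permutation matrices of order 2 *)

Lemma order2_perm_mxP (R : realType) (n : nat) (P : 'M[R]_n) :
  order2_perm_mx P <->
  exists s : {perm 'I_n}, [/\ P = perm_mx s, (s * s = 1)%g & s != 1%g].
Proof.
split=> [[s [Ps s2]]|[s [Ps ss s1]]]; exists s.
  have ss : (s * s = 1)%g by rewrite -(expg_order s) s2.
  by split=> //; apply/eqP => s1; move: s2; rewrite s1 order1.
by split=> //; apply: cyclic.nt_prime_order.
Qed.

Lemma perm_mx_involution (R : pzRingType) (n : nat) (s : {perm 'I_n}) :
  (s * s = 1)%g -> perm_mx s *m perm_mx s = 1%:M :> 'M[R]_n.
Proof. by move=> ss; rewrite -perm_mxM ss perm_mx1. Qed.

Lemma perm_mx_const (R : pzRingType) (n : nat) (s : {perm 'I_n}) (x : R) :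
  perm_mx s *m const_mx x = const_mx x :> 'M[R]_n.
Proof. by rewrite -row_permE row_perm_const. Qed.

Lemma eigenvalue_order2_perm_mx (R : realType) (n : nat) (P : 'M[R]_n) (x : R) :
  order2_perm_mx P -> eigenvalue P x <-> x = 1 \/ x = -1.
Proof.
move=> /order2_perm_mxP[s [-> ss s1]].
have sK z : s (s z) = z by rewrite -permM ss perm1.
split=> [/eigenvalueP[v vP v0]|].
  have /eqP : (x ^+ 2 - 1) *: v = 0.
    rewrite scalerBl scale1r expr2 -scalerA -vP scalemxAl -vP -mulmxA.
    by rewrite perm_mx_involution // mulmx1 subrr.
  rewrite scaler_eq0 (negPf v0) orbF subr_eq0 sqrf_eq1.
  by case/orP => /eqP ->; [left|right].
have [z sz] : exists z, s z != z.
  apply: contrapT => /forallNP sid; case/eqP: s1; apply/permP => z.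
  by rewrite perm1; apply/eqP; apply: contrapT => /negP/sid.
have row_s (v : 'rV[R]_n) y : (v *m perm_mx s) 0 y = v 0 (s y).
  rewrite mxE (bigD1 (s y)) //= big1 ?addr0 => [|w wy]; rewrite !mxE.
    by rewrite sK eqxx mulr1.
  rewrite (_ : s w == y = false) ?mulr0 //.
  by apply/negP => /eqP sw; case/eqP: wy; rewrite -sw sK.
case=> ->; apply/eigenvalueP.
  exists (const_mx 1).
    by apply/rowP => y; rewrite row_s !mxE mulr1.
  by apply/eqP => /rowP/(_ z)/eqP; rewrite !mxE oner_eq0.
(* The difference of the basis vectors at [z] and [s z], which [s] swaps; it is nonzero because [z]
   is moved. *)
exists (\row_y ((y == z)%:R - (y == s z)%:R)).
  apply/rowP => y; rewrite row_s !mxE mulN1r opprB (inj_eq perm_inj).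
  by rewrite -(inj_eq (@perm_inj _ s)) sK.
apply/eqP => /rowP/(_ z)/eqP; rewrite !mxE eqxx [z == _]eq_sym (negPf sz) subr0.
by rewrite oner_eq0.
Qed.

(* [(alpha, beta)] and [(-alpha, -beta)] describe the same revival up to a phase
   [pi], so the sign of [alpha] may be chosen to make [Im beta] positive. *)
Lemma revival_acos (R : realType) (alpha : R) (beta : R[i]) :
    beta != 0 -> `|alpha%:C| ^+ 2 + `|beta| ^+ 2 = 1 -> `|alpha%:C + beta| = 1 ->
  exists2 alpha' : R, -1 < alpha' < 1 &
    alpha%:C + beta = cis (2 * acos alpha') * (alpha%:C - beta).
Proof.
case: beta => x y b0 n1 n2.
have sq (z : R[i]) : `|z| ^+ 2 = (complex.Re z ^+ 2 + complex.Im z ^+ 2)%:C.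
  by rewrite normc_def -rmorphXn sqr_sqrtr // addr_ge0 // sqr_ge0.
have {}n1 : alpha ^+ 2 + (x ^+ 2 + y ^+ 2) = 1.
  by move: n1; rewrite !sq /= => -[]; rewrite expr0n addr0.
have {}n2 : (alpha + x) ^+ 2 + y ^+ 2 = 1.
  have : `|alpha%:C + (x +i* y)| ^+ 2 = 1 by rewrite n2 expr1n.
  by rewrite sq /= add0r => -[].
have xy0 : 0 < x ^+ 2 + y ^+ 2.
  rewrite lt_def addr_ge0 ?sqr_ge0 // andbT paddr_eq0 ?sqr_ge0 // !sqrf_eq0.
  by apply: contra b0; rewrite eq_complex.
(* The two norm equations differ by the cross term 2 alpha Re(beta). *)
have : alpha * x = 0 by lra.
move/eqP; rewrite mulf_eq0 => /orP[] /eqP z0.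
  (* For alpha = 0 the required ratio is -1 = [cis pi], and acos 0 = pi / 2. *)
  exists 0; first by rewrite ltrN10 ltr01.
  rewrite acos0 [2 * _]mulrC divfK ?pnatr_eq0 // /cis cospi sinpi z0 add0r.
  by simpc.
(* Now beta = i y. The pair (a', |y|) is (alpha, y) up to a common sign; it gives the cosine and
   sine of [acos a'], and doubling the angle cancels the sign. *)
have [a' a2 aE] : exists2 a' : R, a' ^+ 2 = alpha ^+ 2 &
    (a' = alpha /\ Num.sqrt (y ^+ 2) = y) \/ (a' = - alpha /\ Num.sqrt (y ^+ 2) = - y).
  rewrite sqrtr_sqr; have [y0|y0] := leP 0 y.
    by exists alpha => //; left; rewrite ger0_norm.
  by exists (- alpha); rewrite ?sqrrN //; right; rewrite ltr0_norm.
have a'1 : -1 < a' < 1.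
  by rewrite -ltr_norml -(@ltr_pXn2r _ 2) ?nnegrE // expr1n real_normK ?num_real // a2; lra.
exists a' => //.
have a'1w : -1 <= a' <= 1 by case/andP: a'1 => ? ?; rewrite !ltW.
have -> : 2 * acos a' = acos a' + acos a' by rewrite mulr_natl.
rewrite cisD /cis sin_acos // acosK ?in_itv //=.
have -> : 1 - a' ^+ 2 = y ^+ 2 by rewrite a2; move: n1; rewrite z0; lra.
have n3 : alpha ^+ 2 = 1 - y ^+ 2 by rewrite -n1 z0; ring.
apply/eqP; rewrite eq_complex z0 /=.
by case: aE => -[-> ->]; apply/andP; split; apply/eqP; ring: n3.
Qed.

(** * From revival to the form of the transition matrix, and back *)

Section Revival.
Variables (R : realType) (n d : nat) (S E : 'I_d.+1 -> 'M[R]_n).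
Variables (theta : 'I_d.+1 -> R) (tau : R).
Hypothesis hS : association_scheme S.
Hypothesis hE : scheme_idempotents S E.
Local Notation U := (transition_mx (\sum_r theta r *: E r) tau).

Lemma transition_mx_idempotents : U = \sum_r cis (- (theta r * tau)) *: cplx_mx (E r).
Proof.
apply: transition_mx_spectral.
  exact: sum_scheme_idempotents hS hE.
exact: scheme_idempotent_mul hS hE.
Qed.

Lemma transition_mx_const i x y u v : S i x y = 1 -> S i u v = 1 -> U x y = U u v.
Proof.
move=> xy uv; rewrite transition_mx_idempotents !summxE; apply: eq_bigr => r _.
by rewrite !mxE (bose_mesner_const hS (mem_scheme_idempotent hE r) xy uv).
Qed.

Lemma transition_mx_eigen r :
  U *m cplx_mx (E r) = cis (- (theta r * tau)) *: cplx_mx (E r).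
Proof.
have EE s : cplx_mx (E s) *m cplx_mx (E r) = if s == r then cplx_mx (E r) else 0.
  rewrite /cplx_mx -map_mxM (scheme_idempotent_mul hS hE).
  by case: eqP => [->|_] //; rewrite raddf0.
rewrite transition_mx_idempotents mulmx_suml (bigD1 r) //= big1 ?addr0 => [|s sr];
  rewrite -scalemxAl EE ?eqxx //.
by rewrite (negPf sr) scaler0.
Qed.

Lemma revival_entry (A : 'M[R]_n) a b zeta alpha (beta : R[i]) y :
  fractional_revival A a b tau zeta alpha beta ->
  transition_mx A tau y a =
    cis zeta * (alpha%:C * (y == a)%:R + beta * (y == b)%:R).
Proof.
case=> _ _ _ _; rewrite -colE => /colP/(_ y); rewrite !mxE => ->.
by rewrite eqxx !andbT.
Qed.

(** Column [a] of U(tau) has the nonzero value at [b] wherever class [q] meets that column, but it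
    vanishes outside [a] and [b]. *)
Lemma revival_neighbor q a b zeta alpha (beta : R[i]) y :
    fractional_revival (\sum_r theta r *: E r) a b tau zeta alpha beta ->
    S q a b = 1 ->
  S q y a = (y == b)%:R.
Proof.
move=> fr qab; have [ab _ b0 _ _] := fr.
have [Ssym S01 S1 _ _] := hS.
have qba : S q b a = 1 by rewrite -(Ssym q).1 mxE.
case: eqVneq => [-> //|yb].
case: (S01 q y a) => // qya.
have /eqP := transition_mx_const qya qba; rewrite !(revival_entry _ fr).
rewrite eqxx eq_sym (negPf yb) (eq_sym b) (negPf ab) !mulr0 add0r mulr1 addr0.
rewrite (inj_eq (mulfI (cis_neq0 _))).
(* Entries alone cannot exclude [y = a], as alpha may equal beta. But the diagonal belongs to class
   0, so [q] would be 0, against [a != b]. *)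
have [ya|_] := eqVneq y a; last by rewrite mulr0 (negPf b0).
have [q' q'E] := scheme_class hS a a.
have := q'E ord0; rewrite S1 mxE eqxx => /eqP; rewrite eq_sym pnatr_eq1 eqb1 => /eqP q'0.
have := q'E q; rewrite -{1}ya qya => /eqP; rewrite eq_sym pnatr_eq1 eqb1 -q'0 => /eqP q0.
by move: qab; rewrite q0 S1 mxE (negPf ab) => /eqP; rewrite eq_sym oner_eq0.
Qed.

(** Both sides are constant on each class, and each class meets column [a], where they agree. *)
Lemma revival_transition_mx q a b zeta alpha (beta : R[i]) :
    fractional_revival (\sum_r theta r *: E r) a b tau zeta alpha beta ->
    S q a b = 1 ->
  U = cis zeta *: (alpha%:C *: 1%:M + beta *: cplx_mx (S q)).
Proof.
move=> fr qab; have [Ssym _ S1 _ _] := hS.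
apply/matrixP => x y; have [i iE] := scheme_class hS x y.
have xy : S i x y = 1 by rewrite iE eqxx.
have [z az] := scheme_neighbor hS i a.
have za : S i z a = 1 by rewrite -(Ssym i).1 mxE.
rewrite (transition_mx_const xy za) (revival_entry _ fr) !mxE.
(* The identity is also constant on classes, so [x == y] and [z == a] have the same truth value. *)
have := bose_mesner_const hS (mem1_bose_mesner hS) xy za; rewrite !mxE => xyE.
rewrite (bose_mesner_const hS (mem_scheme S q) xy za) (revival_neighbor _ fr qab).
by rewrite -(rmorph_nat (real_complex R) (x == y)) xyE !rmorph_nat.
Qed.

(** Row [a] sums to 1, hence so does every row, which then has a single 1. Symmetry makes the
    resulting map an involution, and it moves [a] to [b]. *)
Lemma revival_order2_perm_mx q a b zeta alpha (beta : R[i]) :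
    fractional_revival (\sum_r theta r *: E r) a b tau zeta alpha beta ->
    S q a b = 1 ->
  order2_perm_mx (S q).
Proof.
move=> fr qab; have [ab _ _ _ _] := fr; have [Ssym S01 S1 _ _] := hS.
have row1 x : \sum_y S q x y = 1.
  rewrite (scheme_row_norm hS q x a) (bigD1 b) //= qab big1 ?addr0 // => y yb.
  by rewrite -(Ssym q).1 mxE (revival_neighbor _ fr qab) (negPf yb).
have /choice[f fE] : forall x, exists z, forall y, S q x y = (y == z)%:R.
  by move=> x; apply: sum_01_eq1 => // y; exact: S01.
have fK : involutive f.
  move=> x; have := fE (f x) x; rewrite -{1}(Ssym q).1 mxE fE eqxx.
  by move/esym/eqP; rewrite pnatr_eq1 eqb1 => /eqP.
apply/order2_perm_mxP; exists (perm (can_inj fK)); split.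
- by apply/matrixP => x y; rewrite fE !mxE permE eq_sym.
- by apply/permP => x; rewrite permM !permE fK.
- apply: contra ab => /eqP/permP/(_ a); rewrite permE perm1 => fa.
  by move/eqP: qab; rewrite fE fa pnatr_eq1 eqb1 eq_sym.
Qed.

Lemma transition_mx_revival q u v zeta alpha (beta : R[i]) :
    u != v -> 0 < tau -> beta != 0 -> `|alpha%:C| ^+ 2 + `|beta| ^+ 2 = 1 ->
    order2_perm_mx (S q) -> S q u v = 1 ->
    U = cis zeta *: (alpha%:C *: 1%:M + beta *: cplx_mx (S q)) ->
  fractional_revival (\sum_r theta r *: E r) u v tau zeta alpha beta.
Proof.
move=> uv tau0 b0 nrm /order2_perm_mxP[s [qs ss _]] quv UE; split=> //.
rewrite UE -scalemxAl mulmxDl -!scalemxAl mul1mx.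
congr (_ *: (_ + _ *: _)); rewrite -colE; apply/colP => y; rewrite !mxE andbT.
have su : s u = v.
  by apply/eqP; move/eqP: quv; rewrite qs !mxE pnatr_eq1 eqb1.
by rewrite qs !mxE rmorph_nat -su -(inj_eq (@perm_inj _ s)) -permM ss perm1.
Qed.

(** * Phases on the idempotents *)

Lemma scheme_idempotent0_eigen q :
  order2_perm_mx (S q) -> S q *m E ord0 = E ord0.
Proof.
have [_ _ ->] := hE; move=> /order2_perm_mxP[s [-> _ _]].
exact: perm_mx_const.
Qed.

Lemma scheme_idempotent_eigen q r : order2_perm_mx (S q) ->
  S q *m E r = E r \/ S q *m E r = - E r.
Proof.
move=> /order2_perm_mxP[s [qs ss _]].
apply: (involution_idempotent hS hE); first exact: mem_scheme.
by rewrite qs perm_mx_involution.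
Qed.

Lemma idempotent_combination q r (l : R) (a b : R[i]) :
    S q *m E r = l *: E r ->
  (a *: 1%:M + b *: cplx_mx (S q)) *m cplx_mx (E r) =
    (a + b * l%:C) *: cplx_mx (E r).
Proof.
move=> SE; rewrite mulmxDl -!scalemxAl mul1mx /cplx_mx -map_mxM SE map_mxZ.
by rewrite scalerA -scalerDl.
Qed.

(** Both sides are the factor by which U(tau) acts on the nonzero matrix [E r]. *)
Lemma transition_phase q zeta (a b : R[i]) r (l : R) :
    U = cis zeta *: (a *: 1%:M + b *: cplx_mx (S q)) -> S q *m E r = l *: E r ->
  cis (- (theta r * tau)) = cis zeta * (a + b * l%:C).
Proof.
move=> UE SE; have := transition_mx_eigen r.
rewrite UE -scalemxAl (idempotent_combination _ _ SE) scalerA => /eqP.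
rewrite -subr_eq0 -scalerBl scaler_eq0 subr_eq0 => /orP[/eqP->//|].
by rewrite /cplx_mx map_mx_eq0 (negPf (scheme_idempotent_neq0 hE r)).
Qed.

(** Since the [E r] sum to 1, a matrix is determined by its products with them. *)
Lemma transition_mx_phases q zeta (a b : R[i]) :
    (forall r, exists2 l : R, S q *m E r = l *: E r &
       cis (- (theta r * tau)) = cis zeta * (a + b * l%:C)) ->
  U = cis zeta *: (a *: 1%:M + b *: cplx_mx (S q)).
Proof.
move=> h; rewrite -[RHS]mulmx1 -[X in _ *m X](map_mx1 (real_complex R)).
rewrite -[X in map_mx _ X](sum_scheme_idempotents hS hE) [X in _ *m X]raddf_sum mulmx_sumr.
rewrite transition_mx_idempotents; apply: eq_bigr => r _ /=.
have [l SE ->] := h r.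
by rewrite -/(cplx_mx _) -scalemxAl (idempotent_combination _ _ SE) scalerA.
Qed.

(** As A_q fixes [E ord0], the phase there is e^(i zeta) (alpha + beta), so alpha + beta has norm 1.
    Eigenvalue 1 repeats this phase; eigenvalue -1 gives alpha - beta, and [revival_acos] writes the
    ratio as a doubled angle. *)
Lemma revival_phase_condition q a b zeta alpha (beta : R[i]) :
    fractional_revival (\sum_r theta r *: E r) a b tau zeta alpha beta ->
    S q a b = 1 ->
  exists2 alpha' : R, -1 < alpha' < 1 & phase_condition E theta (S q) tau alpha'.
Proof.
move=> fr qab; have UE := revival_transition_mx fr qab.
have [_ _ b0 nrm _] := fr.
have := scheme_idempotent0_eigen (revival_order2_perm_mx fr qab).
rewrite -[RHS]scale1r => /(transition_phase UE); rewrite mulr1 => phase0.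
have nab : `|alpha%:C + beta| = 1.
  by have := congr1 Num.norm phase0; rewrite normrM !normr_cis mul1r.
have [alpha' a'1 abE] := revival_acos b0 nrm nab.
exists alpha' => // r r0.
have shift x : cis x * cis (- (theta r * tau)) = cis (- (theta ord0 * tau)) ->
    eqmod2pi ((theta r - theta ord0) * tau) x.
  move=> xE; apply/eqmod2piP; rewrite mulrBl cisD -xE mulrCA.
  by rewrite cisN mulr1.
split=> SE; apply: shift.
  move: SE; rewrite -{2}[E r]scale1r => /(transition_phase UE) ->.
  by rewrite cis0 mul1r mulr1 -phase0.
move: SE; rewrite -scaleN1r => /(transition_phase UE) ->.
by rewrite rmorphN1 mulrN1 mulrCA -abE phase0.
Qed.

(** With phi = acos alpha, alpha + i l sin phi = e^(i l phi) for l = 1 or -1. The choice zeta = -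
    theta_0 tau - phi yields the phases - theta_0 tau and - theta_0 tau - 2 phi that the conditions
    prescribe. *)
Lemma phase_condition_transition_mx q alpha :
    -1 < alpha < 1 -> order2_perm_mx (S q) ->
    phase_condition E theta (S q) tau alpha ->
  U = cis (- (theta ord0 * tau) - acos alpha) *:
        (alpha%:C *: 1%:M + (0 +i* sin (acos alpha)) *: cplx_mx (S q)).
Proof.
move=> a1 q2 ph; have a1w : -1 <= alpha <= 1 by case/andP: a1 => ? ?; rewrite !ltW.
have cisE (l : R) : l = 1 \/ l = -1 ->
    alpha%:C + (0 +i* sin (acos alpha)) * l%:C = cis (l * acos alpha).
  by case=> ->; rewrite /cis ?mulN1r ?mul1r ?cosN ?sinN acosK ?in_itv //=; simpc.
apply: transition_mx_phases => r.
have shift x : eqmod2pi ((theta r - theta ord0) * tau) x ->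
    cis (- (theta r * tau)) = cis (- (theta ord0 * tau) - x).
  move=> [k xE]; apply/eqmod2piP; exists (- k).
  by rewrite rmorphN mulNr -xE; ring.
have [SE|SE] := scheme_idempotent_eigen r q2; [exists 1|exists (-1)].
- by rewrite scale1r.
- rewrite cisE; last by left.
  rewrite mul1r -cisD subrK; have [->//|r0] := eqVneq r ord0.
  by rewrite (shift 0) ?subr0 //; exact: (ph r r0).1.
- by rewrite scaleN1r.
rewrite cisE; last by right.
(* Eigenvalue -1 is impossible at [ord0]: it would give E_0 = - E_0. *)
rewrite mulN1r -cisD; have [r0|r0] := eqVneq r ord0.
  have /eqP := SE; rewrite r0 scheme_idempotent0_eigen // -subr_eq0 opprK.
  rewrite -mulr2n -scaler_nat scaler_eq0 pnatr_eq0 /=.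
  by rewrite (negPf (scheme_idempotent_neq0 hE _)).
rewrite (shift _ ((ph r r0).2 SE)); congr cis; ring.
Qed.

End Revival.

(* In (a)-(b) the scalar alpha ranges over ]-1, 1[, the values which the
   conditions beta != 0 and |alpha|^2 + |beta|^2 = 1 allow: for alpha = 1 or -1,
   (a) and (b) only say that U(tau) is a scalar matrix. *)
Theorem theorem3p1 (R : realType) (n d : nat)
    (S E : 'I_d.+1 -> 'M[R]_n) (theta : 'I_d.+1 -> R)
    (e : rel 'I_n) (a b : 'I_n) (tau : R)
    (hS : association_scheme S) (hE : scheme_idempotents S E)
    (e_sym : symmetric e) (e_irr : irreflexive e)
    (hA : adjacency_mx R e \in bose_mesner S)
    (theta_dec : forall r s : 'I_d.+1, (r <= s)%N -> theta s <= theta r)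
    (A_theta : adjacency_mx R e = \sum_r theta r *: E r)
    (a_neq_b : a != b) (tau_gt0 : 0 < tau) :
  let A := adjacency_mx R e in
  exists q : 'I_d.+1,
    [/\ (* A_q is the unique class which is nonzero in the (a, b) entry *)
        forall i, (S i a b != 0) = (i == q),
        (exists alpha zeta beta, fractional_revival A a b tau zeta alpha beta)
        <->
        (order2_perm_mx (S q) /\
         exists alpha : R, -1 < alpha < 1 /\
           phase_condition E theta (S q) tau alpha),
        order2_perm_mx (S q) ->
          forall x : R, eigenvalue (S q) x <-> x = 1 \/ x = -1,
        (* the alpha of (b) is the alpha of the revival *)
        forall alpha : R, -1 < alpha < 1 ->
          order2_perm_mx (S q) -> phase_condition E theta (S q) tau alpha ->
          exists zeta beta, fractional_revival A a b tau zeta alpha beta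
      & forall alpha zeta beta,
          fractional_revival A a b tau zeta alpha beta ->
          transition_mx A tau =
            cis zeta *: (alpha%:C *: 1%:M + beta *: cplx_mx (S q)) /\
          forall u v, S q u v = 1 ->
            fractional_revival A u v tau zeta alpha beta].
Proof.
move=> A; rewrite {}/A A_theta; have [q qE] := scheme_class hS a b.
have qab : S q a b = 1 by rewrite qE eqxx.
have revival alpha : -1 < alpha < 1 -> order2_perm_mx (S q) ->
    phase_condition E theta (S q) tau alpha ->
    exists zeta beta,
      fractional_revival (\sum_r theta r *: E r) a b tau zeta alpha beta.
  move=> a1 q2 ph; do 2 eexists.
  apply: (transition_mx_revival _ _ _ _ q2 qab
    (phase_condition_transition_mx hS hE a1 q2 ph)) => //.
    (* The strict bounds on alpha place [acos alpha] inside ]0, pi[, so beta = i sin (acos alpha) is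
       nonzero. *)
    have /andP[a1l a1r] := a1; rewrite eq_complex /= eqxx /= gt_eqF //.
    by rewrite sin_gt0_pi // acos_gt0 ?acos_ltpi // ?a1l ?a1r ?ltW.
  rewrite !normc_def -!rmorphXn -rmorphD /= !expr0n add0r addr0 !sqr_sqrtr ?sqr_ge0 //.
  have /andP[/ltW a1l /ltW a1r] := a1.
  by rewrite -{1}(@acosK R alpha) ?in_itv /= ?a1l // cos2Dsin2.
exists q; split.
- by move=> i; rewrite qE pnatr_eq0 eqb0 negbK.
- split=> [[alpha [zeta [beta fr]]]|[q2 [alpha [a1 ph]]]].
    split; first exact: (revival_order2_perm_mx hS hE fr qab).
    have [alpha' a1 ph] := revival_phase_condition hS hE fr qab.
    by exists alpha'.
  by exists alpha; exact: revival.
- by move=> q2 x; exact: eigenvalue_order2_perm_mx.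
- exact: revival.
- move=> alpha zeta beta fr.
  have UE := revival_transition_mx hS hE fr qab; split=> // u v quv.
  have [_ _ b0 nrm _] := fr.
  have q2 := revival_order2_perm_mx hS hE fr qab.
  apply: (transition_mx_revival _ _ b0 nrm q2 quv UE) => //.
  (* If [u = v], the identity, constant on class [q], would be 1 at (a, b). *)
  apply/eqP => uv; have [_ _ S1 _ _] := hS.
  have := bose_mesner_const hS (mem1_bose_mesner hS) qab quv.
  by rewrite !mxE uv eqxx (negPf a_neq_b) => /eqP; rewrite eq_sym oner_eq0.
Qed.
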